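(* Let $n,d,r$ be positive integers, let $\mathcal{T}=(T^i)_{i=1}^d$ be a family of sets $T^i\subseteq\{1,\dots,n\}$ with $\bigcup_{i=1}^d T^i=\{1,\dots,n\}$, and let $H=(h^i)_{i=1}^d\subset\mathbb{R}^r$ be an encoding in convex position. Define: - $D=\{(i,j)\in\{1,\dots,d\}^2 : T^i\cap T^j\neq\emptyset,\ i<j\}$; - $C=\{c^{i,j}:=h^j-h^i : (i,j)\in D\}$; - $\mathcal{L}=\operatorname{span}(C)$; - for $b\in\mathbb{R}^r$, $M(b;\mathcal{L})=\{y\in\mathcal{L} : b\cdot y=0\}$; - $b^1,\dots,b^\Gamma\in\mathbb{R}^r\setminus\{\mathbf{0}\}$ normal directions such that $M(b^1;\mathcal{L}),\dots,M(b^\Gamma;\mathcal{L})$ are the hyperplanes of $\mathcal{L}$ spanned by $C$. If $\dim(\operatorname{span}(C))=\dim(H)$, then for every $(\lambda,z)\in\mathbb{R}^n\times\mathbb{R}^r$ we have $(\lambda,z)\in Q(\mathcal{T},H)$ if and only if $$\sum_{v=1}^n \min_{s\,:\,v\in T^s}\{b^k\cdot h^s\}\,\lambda_v\ \le\ b^k\cdot z\ \le\ \sum_{v=1}^n \max_{s\,:\,v\in T^s}\{b^k\cdot h^s\}\,\lambda_v\qquad\text{for all }k\in\{1,\dots,\Gamma\},$$ $$(\lambda,z)\in\Delta^n\times\operatorname{aff}(H).$$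
   Context: $\Delta^n=\{\lambda\in\mathbb{R}^n_{\ge 0} : \sum_{v=1}^n\lambda_v=1\}$ is the unit simplex. For $T\subseteq\{1,\dots,n\}$, $P(T)=\{\lambda\in\Delta^n : \lambda_v\neq 0 \text{ only if } v\in T\}$. An encoding is a collection $H=(h^i)_{i=1}^d$ of pairwise distinct vectors in $\mathbb{R}^r$; it is in convex position if the set of extreme points of $\operatorname{Conv}(H)$ equals $H$. The embedding is $\operatorname{Em}(\mathcal{T},H)=\bigcup_{i=1}^d\big(P(T^i)\times\{h^i\}\big)\subseteq\mathbb{R}^n\times\mathbb{R}^r$, and $Q(\mathcal{T},H)=\operatorname{Conv}(\operatorname{Em}(\mathcal{T},H))$. $\operatorname{aff}(H)$ is the affine hull of $H$ and $\dim(H)$ is its dimension. A hyperplane of $\mathcal{L}$ spanned by $C$ is a linear subspace of $\mathcal{L}$ of dimension $\dim(\mathcal{L})-1$ that is the linear span of some subset of $C$ (when $\dim\mathcal{L}=1$ this is $\{\mathbf{0}\}$, the span of the empty set); the list $b^1,\dots,b^\Gamma$ contains a normal direction for every such hyperplane. *)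

(* Defs.v *)
From HB Require Import structures.
From mathcomp Require Import all_boot all_order all_algebra.
From mathcomp Require Import boolp classical_sets reals convex.

Set Implicit Arguments.
Unset Strict Implicit.
Unset Printing Implicit Defensive.

Import Order.TTheory GRing.Theory Num.Theory.
Local Open Scope classical_set_scope.
Local Open Scope ring_scope.

Definition Conv (R : realType) (V : lmodType R) (A : set V) : set V :=
  smallest (@convex_set R V) A.

Definition extreme_points (R : realType) (V : lmodType R) (A : set V) : set V :=
  [set x | A x /\ forall (y z : V) (t : R), A y -> A z -> 0 < t < 1 ->
             x = t *: y + (1 - t) *: z -> y = x /\ z = x].

Definition affine_set (R : realType) (V : lmodType R) (A : set V) : Prop :=
  forall (x y : V) (t : R), A x -> A y -> A (t *: x + (1 - t) *: y).

Definition aff (R : realType) (V : lmodType R) (A : set V) : set V :=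
  smallest (@affine_set R V) A.

(* The dimension of an affine subspace x + U is \dim U; affdim is 0 by
   convention on sets that are not translates of a linear subspace, such as
   the empty set. *)
Definition affdim (R : realType) (V : vectType R) (A : set V) : nat :=
  xget 0%N [set k | exists (x : V) (U : {vspace V}),
                      A = [set x + u | u in [set u | u \in U]] /\ \dim U = k].

Lemma affdim_translate (R : realType) (V : vectType R) (x : V)
    (U : {vspace V}) :
  affdim [set x + u | u in [set u | u \in U]] = \dim U.
Proof.
rewrite /affdim; case: xgetP => [k _ [y [W [eqUW <-]]]|/(_ (\dim U))]; last first.
  by case; exists x, U.
suff -> : W = U by [].
have sub x1 x2 (U1 U2 : {vspace V}) :
    [set x1 + u | u in [set u | u \in U1]] =
    [set x2 + u | u in [set u | u \in U2]] -> (U1 <= U2)%VS.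
  move=> e; apply/subvP => u uU1.
  have [w1 w1U /= e1] : [set x2 + u | u in [set u | u \in U2]] (x1 + u).
    by rewrite -e; exists u.
  have [w2 w2U /= e2] : [set x2 + u | u in [set u | u \in U2]] (x1 + 0).
    by rewrite -e; exists 0 => //=; rewrite mem0v.
  have -> : u = w1 - w2.
    rewrite addr0 in e2.
    by apply: (addrI x1); rewrite -e1 -e2 -addrA [w2 + _]addrC subrK.
  exact: memvB.
by apply/eqP; rewrite eqEsubv; apply/andP; split; apply: sub; [symmetry|]; exact: eqUW.
Qed.

Definition simplex (R : realType) (n : nat) : set 'rV[R]_n :=
  [set l | (forall v, 0 <= l 0 v) /\ \sum_(v < n) l 0 v = 1].

Definition simplex_face (R : realType) (n : nat) (S : {set 'I_n}) :
    set 'rV[R]_n :=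
  [set l | simplex l /\ forall v, l 0 v != 0 -> v \in S].

Definition in_convex_position (R : realType) (d r : nat)
    (h : 'I_d -> 'rV[R]_r) : Prop :=
  extreme_points (Conv (range h)) = range h.

Definition Em (R : realType) (n d r : nat) (T : 'I_d -> {set 'I_n})
    (h : 'I_d -> 'rV[R]_r) : set ('rV[R]_n * 'rV[R]_r)%type :=
  \bigcup_(i in [set: 'I_d]) (simplex_face (T i) `*` [set h i]).

Definition Q (R : realType) (n d r : nat) (T : 'I_d -> {set 'I_n})
    (h : 'I_d -> 'rV[R]_r) : set ('rV[R]_n * 'rV[R]_r)%type :=
  Conv (Em T h).

Definition D (n d : nat) (T : 'I_d -> {set 'I_n}) : {set 'I_d * 'I_d} :=
  [set p | (T p.1 :&: T p.2 != finset.set0) && (p.1 < p.2)%N].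

(* The finite set of differences, listed as a sequence. *)
Definition C (R : realType) (n d r : nat) (T : 'I_d -> {set 'I_n})
    (h : 'I_d -> 'rV[R]_r) : seq 'rV[R]_r :=
  [seq h p.2 - h p.1 | p in D T].

Definition dot (R : realType) (r : nat) (x y : 'rV[R]_r) : R :=
  \sum_(i < r) x 0 i * y 0 i.

Definition M (R : realType) (r : nat) (b : 'rV[R]_r) (L : {vspace 'rV[R]_r}) :
    set 'rV[R]_r :=
  [set y | y \in L /\ dot b y = 0].

(* The codimension condition is additive rather than with truncated
   subtraction, so that the zero space has no hyperplane. *)
Definition spanned_hyperplane (R : realType) (r : nat)
    (L : {vspace 'rV[R]_r}) (X : seq 'rV[R]_r) : set {vspace 'rV[R]_r} :=
  [set U | [/\ (U <= L)%VS, (\dim U).+1 = \dim L &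
    exists S : seq 'rV[R]_r, {subset S <= X} /\ U = <<S>>%VS]].

(* The value 0 is only a convention for an empty index set. *)
Definition min_over (R : realType) (I : finType) (P : pred I) (F : I -> R) : R :=
  if [pick i | P i] is Some i0 then F [arg min_(i < i0 | P i) F i]%O else 0.

Definition max_over (R : realType) (I : finType) (P : pred I) (F : I -> R) : R :=
  if [pick i | P i] is Some i0 then F [arg max_(i > i0 | P i) F i]%O else 0.

(* Main.v *)
From HB Require Import structures.
Require Import Defs.
From mathcomp Require Import all_boot all_order all_algebra.
From mathcomp Require Import boolp classical_sets reals convex.
From mathcomp Require Import interval_inference.

Set Implicit Arguments.
Unset Strict Implicit.
Unset Printing Implicit Defensive.

Import Order.TTheory GRing.Theory Num.Theory.
Local Open Scope classical_set_scope.
Local Open Scope ring_scope.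

(** For [l] in the simplex, the fibre of [Q T h] over [l] is the Minkowski sum
of the polytopes [l 0 v *: Conv {h s | v \in T s}], and the two inequalities
attached to a vector [b k] say that [z] lies between the two supporting
hyperplanes of this sum that are normal to [b k].  So they hold on [Q T h]:
each of them defines a convex set of pairs which contains [Em T h]
([Q_sub_halfspace]).

For the converse, let [z] be in the affine hull of the [h i] but outside the
fibre.  A linear form [c] separates [z] from the fibre, so [c] is smaller at
[z] than at [\sum_v l 0 v *: h (s v)], where [h (s v)] is a point at which [c]
is least among the [h i] with [v \in T i] ([separate_Q]).  The point [h (s v)]
stays a minimiser as long as the form does not change sign on a difference
[h j - h i] with [v] in both [T i] and [T j], that is, on an element of
[C T h].  The forms which respect the signs of [c] on [C T h] make up a
polyhedral cone.  It is pointed modulo the forms that vanish on [C T h], hence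
generated by its extreme rays, which are the forms whose kernel is a hyperplane
spanned by [C T h]; since [c] is negative at
[y := z - \sum_v l 0 v *: h (s v)], so is one of these rays
([spanned_separator]).  This uses that [y] lies in the span of [C T h], and here
the assumption on dimensions enters: it makes that span equal to the direction
space of the affine hull of the [h i].  On the span, the ray is a nonzero
multiple of some [b k] ([proportional_on_hyperplane]), so the inequality with
the minima for [b k] fails at [z] if the multiple is positive, and the one with
the maxima if it is negative.

Both separations come from one statement, the fundamental theorem of linear
inequalities ([farkas_facet]): a vector of the span of [X] outside the cone of
[X] is cut off from it by a form whose kernel is, within that span, a hyperplane
spanned by elements of [X]. *)

(** * Finitely generated cones *)

Definition convex_cone (F : numDomainType) (V : lmodType F) (A : set V) : Prop :=
  A 0 /\ forall (a : F) (u v : V), 0 <= a -> A u -> A v -> A (a *: u + v).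

Definition cone (F : numDomainType) (V : lmodType F) (A : set V) : set V :=
  smallest (@convex_cone F V) A.

Lemma cone_convex_cone (F : numDomainType) (V : lmodType F) (A : set V) :
  convex_cone (cone A).
Proof.
split=> [K [[K0 _] _] //|a u v a0 Au Av K [[K0 cK] sAK]].
exact: cK a0 (Au _ (conj (conj K0 cK) sAK)) (Av _ (conj (conj K0 cK) sAK)).
Qed.

Lemma cone_sub (F : numDomainType) (V : lmodType F) (A K : set V) :
  convex_cone K -> A `<=` K -> cone A `<=` K.
Proof. exact: smallest_sub. Qed.

Lemma line_capv (F : fieldType) (V : vectType F) (U : {vspace V}) (x : V) :
  x \notin U -> (<[x]> :&: U = 0)%VS.
Proof.
move=> xU; apply/eqP; rewrite -subv0; apply/subvP => w; rewrite memv_cap memv0.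
case/andP=> /vlineP [k ->]; rewrite rpredZeq (negPf xU) orbF => /eqP ->.
by rewrite scale0r.
Qed.

Lemma dim_span_cons (F : fieldType) (V : vectType F) (X : seq V) (x : V) :
  x \notin <<X>>%VS -> \dim <<x :: X>> = (\dim <<X>>).+1.
Proof.
move=> xX; rewrite span_cons dimv_disjoint_sum ?line_capv // dim_vline.
by case: eqP xX => [->|//]; rewrite mem0v.
Qed.


Lemma scalar_extend (F : fieldType) (V : vectType F) (W : {vspace V}) (x : V)
    (f : {scalar V}) (t : F) :
  x \notin W ->
  exists g : {scalar V}, {in W, g =1 f} /\ g x = t.
Proof.
move=> xW; have dWx := line_capv xW.
have x0 : x != 0 by apply: contraNneq xW => ->; rewrite mem0v.
(* The coordinate along [x] of the projection onto the line of [x]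
   parallel to [W]. *)
pose c (v : V) := coord [tuple x] ord0 (daddv_pi <[x]> W v).
pose g v := f v + (t - f x) * c v.
have lin_g : scalar g.
  by move=> k u v; rewrite /g /c !linearP !mulrDr addrACA mulrCA.
pose gL := GRing.isLinear.Build _ _ _ _ g lin_g.
pose G : {scalar V} := HB.pack g gL.
exists G; split=> [u uW|] /=.
  have := daddv_pi_add dWx (memv_add (mem0v <[x]>) uW).
  rewrite add0r (daddv_pi_id (U := W)) 1?capvC // => /(canRL (addrK _)).
  by rewrite /g /c subrr => ->; rewrite linear0 mulr0 addr0.
have := coord_free (X := [tuple x]) ord0 ord0.
rewrite /g /c daddv_pi_id ?memv_line //= => ->.
  by rewrite mulr1 addrC subrK.
by rewrite free_cons span_nil memv0 x0 nil_free.
Qed.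

Lemma dim_span_kernel (F : fieldType) (V : vectType F) (X : seq V)
    (f : {scalar V}) (y : V) :
  y \in <<X>>%VS -> f y != 0 ->
  (\dim <<[seq x <- X | f x == 0%R]>> < \dim <<X>>)%N.
Proof.
move=> yX fy0; rewrite ltn_neqAle dimvS ?andbT; last first.
  by apply/sub_span => v; rewrite mem_filter => /andP [].
apply: contra fy0 => /eqP eqd.
have : y \in <<[seq x <- X | f x == 0%R]>>%VS.
  suff -> : <<[seq x <- X | f x == 0%R]>>%VS = <<X>>%VS by [].
  apply/eqP; rewrite eqEdim eqd leqnn andbT.
  by apply/sub_span => v; rewrite mem_filter => /andP [].
rewrite -[[seq _ <- _ | _]]in_tupleE => /coord_span ->.
rewrite linear_sum big1 // => i _; rewrite scalarZ.
have /= := mem_nth 0 (ltn_ord i); rewrite mem_filter => /andP [/eqP -> _].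
by rewrite mulr0.
Qed.

(** The fundamental theorem of linear inequalities, by induction on the number
of generators.  A generator [x] independent of the others splits off as a direct
summand.  Otherwise take the form [f] given by induction for [X]; if
[f x < 0], both [x] and [y] are on the negative side of [f], and the induction
hypothesis is applied again after projecting onto the kernel of [f] parallel to
[x]. *)
Lemma farkas_facet (F : realFieldType) (V : vectType F) (X : seq V) (y : V) :
  y \in <<X>>%VS ->
  cone [set` X] y \/
  exists f : {scalar V},
    [/\ {in X, forall x, 0 <= f x}, f y < 0 &
        (\dim <<[seq x <- X | f x == 0]>>).+1 = \dim <<X>>].
Proof.
have [m] := ubnP (size X); elim: m X y => // m IHm [|x X] y /=.
  by rewrite span_nil memv0 => _ /eqP ->; left; case: (cone_convex_cone [set` [::] : seq V]).
rewrite ltnS => sX; have IH := IHm X ^~ sX.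
have [_ CD] := cone_convex_cone [set` x :: X].
have Cx : cone [set` x :: X] x by apply: sub_gen_smallest; rewrite /= mem_head.
have subC : cone [set` X] `<=` cone [set` x :: X].
  apply: cone_sub; first exact: cone_convex_cone.
  by move=> u /= uX; apply: sub_gen_smallest; rewrite /= inE uX orbT.
have [xX|xX] := boolP (x \in <<X>>%VS); last first.
  rewrite {1}span_cons => /memv_addP [_ /vlineP [a ->] [u uX ->]].
  (* A form that vanishes on [X] and is [1] at [x] separates if [a < 0];
     otherwise [u] decides, through forms that vanish at [x]. *)
  have [a0|a0] := ltP a 0.
    have [g [gX gx]] := scalar_extend (\0 : {scalar V}) 1 xX.
    have gX0 v : v \in X -> g v = 0 by move=> vX; rewrite gX ?memv_span.
    right; exists g; split.
    - by move=> v; rewrite inE => /predU1P [->|/gX0 ->]; rewrite // gx ler01.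
    - by rewrite linearD scalarZ gx mulr1 gX // addr0.
    - rewrite /= gx oner_eq0 dim_span_cons //; congr (\dim (span _)).+1.
      by apply/all_filterP/allP => v /gX0 ->.
  case: (IH u uX) => [Cu|[f [fX fu fdim]]].
    by left; apply: (CD) => //; apply: subC.
  have [g [gX gx]] := scalar_extend f 0 xX.
  have gfX v : v \in X -> g v = f v by move=> vX; rewrite gX ?memv_span.
  right; exists g; split.
  - by move=> v; rewrite inE => /predU1P [->|vX]; rewrite ?gx // gfX ?fX.
  - by rewrite linearD scalarZ gx mulr0 add0r gX.
  - rewrite /= gx eqxx (dim_span_cons xX) -fdim (@eq_in_filter _ _ (fun v => f v == 0)).
      rewrite dim_span_cons //; apply: contra xX.
      by apply/subvP/sub_span => v; rewrite mem_filter => /andP [].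
    by move=> v /gfX ->.
have spanX : <<x :: X>>%VS = <<X>>%VS.
  by rewrite span_cons; apply/addv_idPr; rewrite -memvE.
rewrite spanX => yX.
case: (IH y yX) => [Cy|[f [fX fy fdim]]]; first by left; apply: subC.
have [fx|fx] := ltP (f x) 0; last first.
  right; exists f; split=> //.
  - by move=> v; rewrite inE => /predU1P [->|/fX].
  (* Adding [x] cannot enlarge the kernel part to the whole span, as [f y] is
     nonzero. *)
  - apply/eqP; rewrite eqn_leq -{1}spanX; apply/andP; split.
      by apply: (@dim_span_kernel _ _ (x :: X) f y); rewrite ?spanX ?lt_eqF.
    rewrite -fdim ltnS dimvS //; case: ifP => // _.
    by apply: sub_span => v vX; rewrite inE vX orbT.
pose p v := v - (f v / f x) *: x.
have lin_p : linear p.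
  move=> k u v; rewrite /p linearP mulrDl scalerDl opprD addrACA.
  by rewrite scalerBr scalerA mulrA.
pose pL := GRing.isLinear.Build _ _ _ _ p lin_p.
pose P : {linear V -> V} := HB.pack p pL.
have x0 : x != 0 by apply: contraTneq fx => ->; rewrite linear0 ltxx.
have Px : P x = 0 by rewrite /= /p divff ?scale1r ?subrr // lt_eqF.
(* Projecting a family whose span contains [x] lowers its rank by one, for the
   whole family as well as for its part in the kernel of a form. *)
have dimP (Y : seq V) : x \in <<Y>>%VS -> \dim <<Y>> = (\dim <<map P Y>>).+1.
  move=> xY; rewrite -(limg_ker_dim (linfun P) <<Y>>%VS) limg_span.
  rewrite (eq_map (lfunE P)) (_ : _ :&: _ = <[x]>)%VS ?dim_vline ?x0 //.
  apply/eqP; rewrite eqEsubv -memvE memv_cap xY memv_ker lfunE Px eqxx !andbT.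
  apply/subvP => w; rewrite memv_cap memv_ker lfunE /= /p subr_eq0.
  by case/andP=> _ /eqP ->; rewrite memvZ ?memv_line.
have PyX : P y \in <<map P X>>%VS.
  by rewrite -(eq_map (lfunE P)) -limg_span -(lfunE P) memv_img.
have sPX : (size (map P X) < m)%N by rewrite size_map.
have [Cy|[g [gX gy gdim]]] := IHm (map P X) (P y) sPX PyX.
  (* [p] moves [y] by a nonpositive multiple of [x] and each element of [X] by
     a nonnegative one; adding a nonnegative multiple of [x] stays in the cone. *)
  left; rewrite -(subrK ((f y / f x) *: x) y) addrC; apply: (CD) => //.
    by rewrite ltW // nmulr_rgt0 ?invr_lt0.
  apply: (cone_sub (A := [set` map P X])) Cy; first exact: cone_convex_cone.
  move=> _ /= /mapP [v vX ->]; rewrite /= /p addrC -scaleNr; apply: (CD) => //.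
    by rewrite -mulrN mulr_ge0 ?fX // oppr_ge0 invr_le0 ltW.
  by apply: subC; apply: sub_gen_smallest.
right; exists (g \o P); split=> //.
  move=> v; rewrite inE => /predU1P [->|vX] /=; first by rewrite [p x]Px linear0.
  by apply: gX; apply: map_f.
have gPx : g (p x) = 0 by rewrite [p x]Px linear0.
have span0 (Z : seq V) : <<(0%R : V) :: Z>>%VS = <<Z>>%VS.
  by rewrite span_cons; apply/addv_idPr; rewrite -memvE mem0v.
rewrite /= gPx eqxx -spanX (dimP (x :: _)) ?memv_span ?mem_head //.
rewrite (dimP (x :: X)) ?memv_span ?mem_head //.
by rewrite !map_cons Px !span0 -gdim filter_map.
Qed.

Lemma farkas (F : realFieldType) (V : vectType F) (X : seq V) (y : V) :
  cone [set` X] y \/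
  exists f : {scalar V}, {in X, forall x, 0 <= f x} /\ f y < 0.
Proof.
have [yX|yX] := boolP (y \in <<X>>%VS).
  by case: (farkas_facet yX) => [|[f [fX fy _]]]; [left | right; exists f].
have [g [gX gy]] := scalar_extend (\0 : {scalar V}) (-1) yX.
right; exists g; rewrite gy oppr_lt0 ltr01; split=> // x xX.
by rewrite gX ?memv_span.
Qed.

(** * Convex and affine hulls *)

Lemma convex_setP (R : numDomainType) (V : lmodType R) (A : set V) :
  convex_set A <->
  forall (x y : V) (t : R), 0 <= t -> t <= 1 -> A x -> A y ->
    A (t *: x + (1 - t) *: y).
Proof.
split=> [cA x y t t0 t1 /mem_set Ax /mem_set Ay|cA x y t /set_mem Ax /set_mem Ay].
  exact: set_mem (cA x y (Itv01 t0 t1) Ax Ay).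
by apply/mem_set; apply: cA => //.
Qed.

(** The zero vector is added by hand so that [A] may be empty; this makes the
set the cone of [A] for every convex [A]. *)
Lemma convex_cone_convex (F : realFieldType) (V : lmodType F) (A : set V) :
  convex_set A ->
  convex_cone [set u | u = 0 \/ exists t q, [/\ 0 < t, A q & u = t *: q]].
Proof.
move/convex_setP=> cA; split=> [|a u v a0]; first by left.
have [-> _|a_neq0] := eqVneq a 0; first by rewrite scale0r add0r.
have {a_neq0}a0 : 0 < a by rewrite lt_neqAle eq_sym a_neq0.
case=> [->|[t [q [t0 Aq ->]]]]; first by rewrite scaler0 add0r.
case=> [->|[t' [q' [t0' Aq' ->]]]]; right.
  by exists (a * t), q; rewrite scalerA addr0 mulr_gt0.
have s0 : 0 < a * t + t' by rewrite addr_gt0 ?mulr_gt0.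
exists (a * t + t'), (a * t / (a * t + t') *: q + (1 - a * t / (a * t + t')) *: q').
split=> //.
  apply: cA => //; first by rewrite divr_ge0 // ltW // mulr_gt0.
  by rewrite ler_pdivrMr // mul1r lerDl ltW.
rewrite scalerDr !scalerA mulrBr mulr1 mulrCA divff ?gt_eqF // mulr1.
by rewrite [a * t + _]addrC addrK.
Qed.

Lemma affine_set_aff (R : realType) (V : lmodType R) (A : set V) :
  affine_set (aff A).
Proof. by move=> x y t Ax Ay B BA; apply: BA.1; [apply: Ax | apply: Ay]. Qed.

(** This is the description of the hull from which [affdim] is computed. *)
Lemma aff_range (R : realType) (V : vectType R) (d : nat) (h : 'I_d -> V)
    (i0 : 'I_d) :
  aff (range h) =
  [set h i0 + u | u in [set u | u \in <<[seq h i - h i0 | i : 'I_d]>>%VS]].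
Proof.
apply/seteqP; split.
  apply: smallest_sub.
    move=> _ _ t [u uU <-] [v vV <-].
    exists (t *: u + (1 - t) *: v); first by rewrite /= memvD ?memvZ.
    by rewrite !scalerDr addrACA -scalerDl subrKC scale1r.
  move=> _ [i _ <-]; exists (h i - h i0); last by rewrite subrKC.
  by apply: memv_span; apply: map_f; rewrite mem_enum.
have hA i : aff (range h) (h i) by apply: sub_gen_smallest; exists i.
(* The translations taking [h i0] into the hull are closed under scaling, and
   under addition as [u + v] is twice the midpoint of [u] and [v]. *)
pose K u := aff (range h) (h i0 + u).
have KZ t u : K u -> K (t *: u).
  move=> Ku; have := affine_set_aff t Ku (hA i0).
  by rewrite scalerDr addrAC -scalerDl subrKC scale1r.
have KD u v : K u -> K v -> K (u + v).
  move=> Ku Kv; rewrite -[u + v](scalerK (a := 2)) ?pnatr_eq0 //.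
  rewrite scalerA mulrC -scalerA; apply: (KZ).
  have := affine_set_aff 2^-1 Ku Kv.
  have half : 2^-1 + 2^-1 = 1 :> R by rewrite [RHS]splitr !mul1r.
  have -> : 1 - 2^-1 = 2^-1 :> R by apply/eqP; rewrite subr_eq half.
  by rewrite !scalerDr addrACA -scalerDl half scale1r -scalerDr.
move=> _ [u uU <-]; move: uU; rewrite /= -[[seq _ | _ in _]]in_tupleE.
move=> /coord_span ->; apply: (big_ind K) => //.
- by rewrite /K addr0.
- move=> i _; apply: (KZ); have := mem_nth 0 (ltn_ord i).
  by case/mapP=> j _ /= ->; rewrite /K subrKC.
Qed.

(** * Minima and maxima over a finite index set *)

Section MinMax.
Variables (R : realType) (I : finType) (P : pred I).
Implicit Types f : I -> R.

Lemma min_over_le f i : P i -> min_over P f <= f i.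
Proof.
rewrite /min_over; case: pickP => [i0 Pi0|/(_ i) -> //] Pi.
by case: Order.TotalTheory.arg_minP => // j _; apply.
Qed.

Lemma max_over_ge f i : P i -> f i <= max_over P f.
Proof.
rewrite /max_over; case: pickP => [i0 Pi0|/(_ i) -> //] Pi.
by case: Order.TotalTheory.arg_maxP => // j _; apply.
Qed.

Lemma min_over_eq f i :
  P i -> (forall j, P j -> f i <= f j) -> min_over P f = f i.
Proof.
move=> Pi fi; apply/eqP; rewrite eq_le min_over_le //=.
rewrite /min_over; case: pickP => [i0 Pi0|/(_ i)]; last by rewrite Pi.
by case: Order.TotalTheory.arg_minP => // j /fi.
Qed.

Lemma max_over_eq f i :
  P i -> (forall j, P j -> f j <= f i) -> max_over P f = f i.
Proof.
move=> Pi fi; apply/eqP; rewrite eq_le max_over_ge ?andbT //.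
rewrite /max_over; case: pickP => [i0 Pi0|/(_ i)]; last by rewrite Pi.
by case: Order.TotalTheory.arg_maxP => // j /fi.
Qed.

End MinMax.

(** * Linear forms with a spanned kernel *)

Lemma dot_is_scalar (R : realType) (r : nat) (b : 'rV[R]_r) : scalar (dot b).
Proof.
move=> k u v; rewrite /dot mulr_sumr -big_split /=; apply: eq_bigr => i _.
by rewrite !mxE mulrDr mulrCA.
Qed.

HB.instance Definition _ (R : realType) (r : nat) (b : 'rV[R]_r) :=
  GRing.isLinear.Build _ _ _ _ (dot b) (dot_is_scalar b).

Lemma span_up_to_sign (F : fieldType) (V : vectType F) (X Y : seq V) :
  {in X, forall x, (x \in Y) || (- x \in Y)} -> (<<X>> <= <<Y>>)%VS.
Proof.
move=> XY; apply/span_subvP => x /XY /orP [] /memv_span //.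
by rewrite memvN.
Qed.

(** A form that is negative at [y] can be turned into one whose kernel is a
hyperplane spanned by [X] without losing its sign on any element of [X], weakly,
nor at [y].  Orienting the elements of [X] and their opposites to the
nonnegative side of [c] gives a cone that misses [y], to which [farkas_facet]
applies. *)
Lemma spanned_separator (R : realType) (r : nat) (X : seq 'rV[R]_r)
    (c : {scalar 'rV[R]_r}) (y : 'rV[R]_r) :
  y \in <<X>>%VS -> c y < 0 ->
  exists (g : {scalar 'rV[R]_r}) (U : {vspace 'rV[R]_r}),
    [/\ spanned_hyperplane <<X>>%VS X U, {in U, forall u, g u = 0}, g y < 0,
        {in X, forall x, 0 <= c x -> 0 <= g x} &
        {in X, forall x, c x <= 0 -> g x <= 0}].
Proof.
move=> yX cy; pose Y := [seq x <- X ++ [seq - x | x <- X] | 0 <= c x].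
have memY x : (x \in Y) = (0 <= c x) && ((x \in X) || (- x \in X)).
  rewrite mem_filter mem_cat -[x in x \in map _ _]opprK mem_map //.
  exact: oppr_inj.
move: Y memY => Y memY.
have XY x : x \in X -> (x \in Y) || (- x \in Y).
  by move=> xX; rewrite !memY opprK xX orbT !andbT linearN oppr_ge0 ge_total.
have YX x : x \in Y -> (x \in X) || (- x \in X) by rewrite memY => /andP [].
have spanY : <<Y>>%VS = <<X>>%VS.
  by apply/eqP; rewrite eqEsubv !span_up_to_sign.
rewrite -spanY in yX; have [Cy|[g [gY gy gdim]]] := farkas_facet yX.
  exfalso; suff : 0 <= c y by rewrite leNgt cy.
  apply: (cone_sub (K := [set u | 0 <= c u])) Cy.
    split=> /= [|a u v a0 cu cv]; first by rewrite linear0.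
    by rewrite linearP addr_ge0 ?mulr_ge0.
  by move=> x /=; rewrite memY => /andP [].
exists g, <<[seq x <- X | g x == 0%R]>>%VS.
have gYX : <<[seq x <- Y | g x == 0%R]>>%VS = <<[seq x <- X | g x == 0%R]>>%VS.
  apply/eqP; rewrite eqEsubv; apply/andP.
  split; apply: span_up_to_sign => x;
    rewrite !mem_filter linearN oppr_eq0 => /andP [-> /=].
    exact: YX.
  exact: XY.
split=> //.
- split; first by apply: sub_span => x; rewrite mem_filter => /andP [].
    by rewrite -gYX gdim spanY.
  by exists [seq x <- X | g x == 0]; split=> // x; rewrite mem_filter => /andP [].
- move=> u; rewrite -[[seq _ <- _ | _]]in_tupleE => /coord_span ->.
  rewrite linear_sum big1 // => i _; rewrite scalarZ.
  have /= := mem_nth 0 (ltn_ord i); rewrite mem_filter => /andP [/eqP -> _].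
  by rewrite mulr0.
- by move=> x xX cx; apply: gY; rewrite memY cx xX.
- move=> x xX cx; rewrite -oppr_ge0 -linearN; apply: gY.
  by rewrite memY opprK xX orbT linearN oppr_ge0 cx.
Qed.

Lemma proportional_on_hyperplane (F : fieldType) (V : vectType F)
    (U L : {vspace V}) (f g : {scalar V}) (y : V) :
  (U <= L)%VS -> (\dim U).+1 = \dim L -> y \in L ->
  {in U, forall u, f u = 0} -> {in U, forall u, g u = 0} -> g y != 0 ->
  {in L, forall x, f x = f y / g y * g x}.
Proof.
move=> UL dimU yL fU gU gy0 x xL.
have yU : y \notin U by apply: contra gy0 => /gU ->.
have : x \in (<[y]> + U)%VS.
  suff -> : (<[y]> + U)%VS = L by [].
  apply/eqP; rewrite eqEdim subv_add -memvE yL UL -dimU /=.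
  rewrite dimv_disjoint_sum ?line_capv // dim_vline.
  by case: eqP yU => [->|]; rewrite ?mem0v.
case/memv_addP=> _ /vlineP [k ->] [u uU ->].
by rewrite !linearD !scalarZ (fU u uU) (gU u uU) !addr0 mulrCA divfK.
Qed.

(** * Inequalities valid on the embedding polytope *)

Lemma convex_simplex (R : realType) (n : nat) : convex_set (@simplex R n).
Proof.
apply/convex_setP => x y t t0 t1 [x0 x1] [y0 y1]; split=> [v|].
  by rewrite !mxE addr_ge0 ?mulr_ge0 ?subr_ge0.
under eq_bigr do rewrite !mxE.
by rewrite big_split -!mulr_sumr /= x1 y1 !mulr1 subrKC.
Qed.

Lemma Q_sub_simplex (R : realType) (n d r : nat) (T : 'I_d -> {set 'I_n})
    (h : 'I_d -> 'rV[R]_r) p :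
  Q T h p -> simplex p.1.
Proof.
apply: (smallest_sub (X := [set p | simplex p.1])) => [|_ [i _ [[? _] _]]] //.
apply/convex_setP => x y t t0 t1 xs ys.
by have /convex_setP := @convex_simplex R n; apply.
Qed.

Lemma Q_sub_aff (R : realType) (n d r : nat) (T : 'I_d -> {set 'I_n})
    (h : 'I_d -> 'rV[R]_r) p :
  Q T h p -> aff (range h) p.2.
Proof.
apply: (smallest_sub (X := [set p | aff (range h) p.2])) => [|[l _] [i _ [_ /= ->]]].
  by apply/convex_setP => x y t _ _; apply: affine_set_aff.
by apply: sub_gen_smallest; exists i.
Qed.

(** Taking [f] to be [dot (b k)] or its opposite gives both families of
inequalities.  At a point of [Em T h] over [h i], only the [v \in T i]
contribute to the sum. *)
Lemma Q_sub_halfspace (R : realType) (n d r : nat) (T : 'I_d -> {set 'I_n})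
    (h : 'I_d -> 'rV[R]_r) (f : {scalar 'rV[R]_r}) (m : 'I_n -> R) p :
  (forall v s, v \in T s -> m v <= f (h s)) ->
  Q T h p -> \sum_v m v * p.1 0 v <= f p.2.
Proof.
move=> mh; pose K := [set q : 'rV[R]_n * 'rV[R]_r | \sum_v m v * q.1 0 v <= f q.2].
apply: (smallest_sub (X := K)) => [|[l _] [i _ [/= [[l0 l1] lT] ->]]].
  apply/convex_setP => x y t t0 t1 xK yK; rewrite /K /=.
  under eq_bigr do rewrite !mxE mulrDr !(mulrCA (m _)).
  rewrite big_split -!mulr_sumr linearD !scalarZ lerD // ler_wpM2l //.
  by rewrite subr_ge0.
rewrite /K /= -[f _]mulr1 -l1 mulr_sumr ler_sum // => v _.
have [-> |/lT vT] := eqVneq (l 0 v) 0; first by rewrite !mulr0.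
by rewrite ler_wpM2r ?mh.
Qed.

(** * Separation from the embedding polytope *)

(** Since the coordinates of [l] sum to one, [(l, z)] is in [Q T h] as soon as
it is in the cone of the pairs [(delta_mx 0 v, h i)] with [v \in T i].
Otherwise a form [f] that is nonnegative on these pairs is negative at
[(l, z)], and [c] is its restriction to the second factor.  Subtracting from
[(l, z)] the nonnegative combination of pairs with coefficients [l 0 v] leaves
a vector of the second factor, at which [c] is even smaller. *)
Lemma separate_Q (R : realType) (n d r : nat) (T : 'I_d -> {set 'I_n})
    (h : 'I_d -> 'rV[R]_r) (l : 'rV[R]_n) (z : 'rV[R]_r) :
  (\bigcup_(i < d) T i)%SET = [set: 'I_n]%SET -> simplex l ->
  Q T h (l, z) \/
  exists (c : {scalar 'rV[R]_r}) (s : 'I_n -> 'I_d),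
    [/\ forall v, v \in T (s v),
        forall v i, v \in T i -> c (h (s v)) <= c (h i) &
        c (z - \sum_v l 0 v *: h (s v)) < 0].
Proof.
move=> cover [l0 l1].
pose G : seq ('rV[R]_n * 'rV[R]_r) :=
  [seq (delta_mx 0 p.1, h p.2) | p in [pred p : 'I_n * 'I_d | p.1 \in T p.2]].
have [Gl|[f [fG fl]]] := farkas G (l, z).
  left; pose K : set ('rV[R]_n * 'rV[R]_r) :=
    [set u | u = 0 \/ exists t q, [/\ 0 < t, Q T h q & u = t *: q]].
  have /(_ _ Gl) : cone [set` G] `<=` K.
    apply: cone_sub.
      apply: convex_cone_convex; apply/convex_setP => x y t t0 t1 Qx Qy A [cA EA].
      by move/convex_setP: (cA); apply=> //; [apply: Qx | apply: Qy].
    move=> _ /mapP [[v i] vi ->]; right; exists 1, (delta_mx 0 v, h i).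
    rewrite scale1r ltr01; split=> //; apply: sub_gen_smallest; exists i => //.
    rewrite mem_enum inE /= in vi.
    split=> //=; split; first split.
    - by move=> w; rewrite mxE ler0n.
    - rewrite (bigD1 v) //= mxE !eqxx big1 ?addr0 // => w wv.
      by rewrite mxE (negPf wv) andbF.
    - by move=> w; rewrite mxE; case: (w =P v) => [-> //|_]; rewrite andbF eqxx.
  case=> [[lz _]|[t [q [t0 Qq lz]]]].
    move: l1; rewrite lz big1 => [/eqP|v _]; last by rewrite mxE.
    by rewrite eq_sym oner_eq0.
  suff t1 : t = 1 by rewrite lz t1 scale1r.
  have [_ q1] := Q_sub_simplex Qq.
  rewrite -l1 -[t]mulr1 -q1 mulr_sumr; apply: eq_bigr => v _.
  by case: lz => -> _; rewrite mxE.
right.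
have lin_c : scalar (fun u : 'rV[R]_r => f (0, u)).
  move=> k u v; rewrite -linearP /= -[LHS]/(f _).
  by congr (f (_, _)); rewrite /= ?scaler0 ?addr0.
pose cL := GRing.isLinear.Build _ _ _ _ _ lin_c.
pose c : {scalar 'rV[R]_r} := HB.pack (fun u : 'rV[R]_r => f (0, u)) cL.
have fE v i : f (delta_mx 0 v, h i) = f (delta_mx 0 v, 0) + c (h i).
  by rewrite -linearD; congr (f (_, _)); rewrite ?addr0 ?add0r.
have : exists s : 'I_n -> 'I_d,
    forall v, v \in T (s v) /\ forall i, v \in T i -> c (h (s v)) <= c (h i).
  apply: (@fin_all_exists _ (fun=> 'I_d) (fun v s => v \in T s /\
    forall i, v \in T i -> c (h s) <= c (h i))) => v.
  have /bigcupP [i0 _ vi0] : v \in (\bigcup_(i < d) T i)%SET by rewrite cover inE.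
  case: (@Order.TotalTheory.arg_minP _ _ _ i0 (fun i => v \in T i)
    (fun i => c (h i))) => // i vi ci.
  by exists i.
case=> s sP; exists c, s; split=> [v|v|]; [by case: (sP v) | by case: (sP v) |].
have lE : (l, z) = \sum_v l 0 v *: (delta_mx 0 v, h (s v))
                   + (0, z - \sum_v l 0 v *: h (s v)).
  rewrite [RHS]surjective_pairing /=; congr (_, _).
    rewrite (big_morph fst (fun _ _ => erefl) erefl) /= addr0.
    exact: row_sum_delta.
  by rewrite (big_morph snd (fun _ _ => erefl) erefl) /= subrKC.
move: fl; rewrite lE linearD linear_sum -/(c _); apply: le_lt_trans.
rewrite lerDr sumr_ge0 // => v _; rewrite scalarZ mulr_ge0 // fG //.
by apply/mapP; exists (v, s v); rewrite ?mem_enum ?inE //=; case: (sP v).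
Qed.

(** * Sufficiency of the spanned normals *)

Theorem theorem1 (R : realType) (n d r : nat)
    (n_gt0 : (0 < n)%N) (d_gt0 : (0 < d)%N) (r_gt0 : (0 < r)%N)
    (T : 'I_d -> {set 'I_n})
    (T_cover : (\bigcup_(i < d) T i)%SET = [set: 'I_n]%SET)
    (h : 'I_d -> 'rV[R]_r)
    (h_inj : injective h)
    (h_convex : in_convex_position h)
    (Gamma : nat) (b : 'I_Gamma -> 'rV[R]_r)
    (b_neq0 : forall k, b k != 0)
    (b_normals :
       range (fun k => M (b k) <<C T h>>%VS) =
       [set [set y | y \in U] | U in spanned_hyperplane <<C T h>>%VS (C T h)])
    (dim_eq : \dim <<C T h>>%VS = affdim (aff (range h))) :
  forall (lambda : 'rV[R]_n) (z : 'rV[R]_r),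
    Q T h (lambda, z) <->
    (forall k : 'I_Gamma,
       \sum_(v < n) min_over (fun s => v \in T s) (fun s => dot (b k) (h s))
                    * lambda 0 v
         <= dot (b k) z
         <= \sum_(v < n) max_over (fun s => v \in T s) (fun s => dot (b k) (h s))
                    * lambda 0 v) /\
    (simplex lambda /\ aff (range h) z).
Proof.
move=> l z; split=> [Qlz|[ineq [l_simplex z_aff]]].
  split; last by split; [apply: (Q_sub_simplex Qlz) | apply: (Q_sub_aff Qlz)].
  move=> k; apply/andP; split.
    by apply: (Q_sub_halfspace (f := dot (b k))) Qlz => v s vs; apply: min_over_le.
  rewrite -lerN2 -linearN -sumrN.
  under eq_bigr do rewrite -mulNr.
  pose f : {scalar 'rV[R]_r} := \- dot (b k).
  rewrite linearN; apply: (Q_sub_halfspace (f := f)) Qlz => v s vs.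
  by rewrite /f /= lerN2 (max_over_ge (fun s => dot (b k) (h s))).
set L := <<C T h>>%VS in b_normals dim_eq.
pose i0 := Ordinal d_gt0.
have C_diff i j v : v \in T i -> v \in T j -> (i < j)%N -> h j - h i \in C T h.
  move=> vi vj ij; apply/mapP; exists (i, j) => //.
  rewrite mem_enum inE /= ij andbT.
  by apply/set0Pn; exists v; rewrite inE vi.
(* [L] is contained in the direction space of the affine hull, and [dim_eq]
   turns the inclusion into an equality. *)
have LE : L = <<[seq h i - h i0 | i : 'I_d]>>%VS.
  apply/eqP; rewrite eqEdim dim_eq (aff_range h i0) affdim_translate leqnn andbT.
  apply/span_subvP => _ /mapP [[i j] _ ->] /=.
  rewrite -(subrKA (h i0)) -[h i0 - h i]opprB memvB //;
    by apply: memv_span; apply: map_f; rewrite mem_enum.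
have affL x i : aff (range h) x -> x - h i \in L.
  rewrite (aff_range h i0) -LE => -[u uL <-].
  rewrite addrAC -opprB memvD ?memvN // LE memv_span //.
  by apply: map_f; rewrite mem_enum.
case: (separate_Q h z T_cover l_simplex) => // -[c [s [sT cs cy]]].
set y := z - _ in cy.
have [_ l1] := l_simplex.
have yL : y \in L.
  have -> : y = \sum_v l 0 v *: (z - h (s v)).
    under [RHS]eq_bigr do rewrite scalerBr.
    by rewrite sumrB -scaler_suml l1 scale1r.
  by apply: memv_suml => v _; rewrite memvZ ?affL.
have [g [U [hypU gU gy gp gn]]] := spanned_separator yL cy.
(* [g] keeps the signs of [c] on [C T h], so each [s v] still minimises it. *)
have gs v i : v \in T i -> g (h (s v)) <= g (h i).
  move=> vi; have := cs v i vi.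
  rewrite -subr_ge0 -linearB -[in X in _ -> X]subr_ge0 -linearB.
  have [svi|isv|/val_inj ->] := ltngtP (s v) i.
  - by apply: gp; apply: (C_diff _ _ v).
  - rewrite -opprB !(linearN _ (h (s v) - h i)) !oppr_ge0.
    by apply: gn; apply: (C_diff _ _ v).
  - by rewrite subrr !linear0.
have : [set [set y | y \in U] | U in spanned_hyperplane L (C T h)] [set y | y \in U].
  by exists U.
rewrite -b_normals => -[k _ MU].
have bU : {in U, forall u, dot (b k) u = 0}.
  move=> u uU; have : [set y | y \in U] u by [].
  by rewrite -MU => -[].
have by0 : dot (b k) y != 0.
  apply: contraTneq gy => by0; rewrite -leNgt gU //.
  by have : M (b k) L y by []; rewrite MU.
have [UL dimU _] := hypU.
have prop := proportional_on_hyperplane UL dimU yL gU bU by0.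
set tau := g y / dot (b k) y in prop.
have diffL v i : h i - h (s v) \in L.
  by apply: affL; apply: sub_gen_smallest; exists i.
(* Hence [s v] minimises [dot (b k)] over the [h i] with [v \in T i] if
   [tau > 0], and maximises it if [tau < 0]. *)
have gdiff v i :
    v \in T i -> 0 <= tau * (dot (b k) (h i) - dot (b k) (h (s v))).
  by move=> vi; rewrite -linearB -prop // linearB subr_ge0 gs.
have sumE : \sum_v dot (b k) (h (s v)) * l 0 v = dot (b k) z - dot (b k) y.
  rewrite /y linearB opprB addrCA subrr addr0 linear_sum; apply: eq_bigr => v _.
  by rewrite scalarZ mulrC.
have /andP [lo hi] := ineq k.
have tau0 : tau != 0.
  by apply: contraTneq gy => tau0; rewrite prop // tau0 mul0r ltxx.
have [tau_gt0|tau_le0] := ltP 0 tau.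
  move: lo; under eq_bigr => v _.
    rewrite (@min_over_eq _ _ _ _ (s v)) //; last first.
      by move=> i /gdiff; rewrite pmulr_rge0 // subr_ge0.
    over.
  rewrite sumE gerBl leNgt => /negP []; move: tau_gt0 gy.
  by rewrite (prop y yL) => ?; rewrite pmulr_rlt0.
have tau_lt0 : tau < 0 by rewrite lt_neqAle tau0.
move: hi; under eq_bigr => v _.
  rewrite (@max_over_eq _ _ _ _ (s v)) //; last first.
    by move=> i /gdiff; rewrite nmulr_rge0 // subr_le0.
  over.
rewrite sumE lerBrDr gerDl leNgt => /negP []; move: gy.
by rewrite (prop y yL) nmulr_rlt0.
Qed.
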